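(* Let $n\in\mathbb Z^+$, and let $I\sqcup J$ be a partition of $\binom{[n]}{2}$, the set of unordered pairs of elements of $[n]$. Let $w:I\to\mathbb R^{\ge0}$ and $r:J\to\mathbb R^{+}$. There exists at most one connected weighted graph $G=([n],E,w_G)$ whose edge weights on $I$ agree with $w$ and whose effective resistances on $J$ agree with $r$, i.e., $w_G(i,j)=w(i,j)$ for all $\{i,j\}\in I$ and $R_G(i,j)=r(i,j)$ for all $\{i,j\}\in J$.
   Context: A weighted graph on $[n]$ is given by nonnegative weights $w_G(i,j)$ on unordered pairs (weight $0$ meaning no edge). Its Laplacian is $L=D-A$ with $A_{ij}=w_G(i,j)$ and $D$ the diagonal weighted-degree matrix, and $R_G(i,j)=(\mathbf{1}_i-\mathbf{1}_j)^TL^+(\mathbf{1}_i-\mathbf{1}_j)$ is the effective resistance, $L^+$ the pseudoinverse. *)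

(* Defs.v *)
From HB Require Import structures.
From mathcomp Require Import all_boot all_order all_algebra.
From mathcomp Require Import boolp classical_sets reals.

Set Implicit Arguments.
Unset Strict Implicit.
Unset Printing Implicit Defensive.

Import Order.TTheory GRing.Theory Num.Theory.

Local Open Scope ring_scope.

(* The four Penrose equations. *)
Definition is_mpinv (R : realType) (m n : nat)
    (A : 'M[R]_(m, n)) (X : 'M[R]_(n, m)) : Prop :=
  [/\ A *m X *m A = A,
      X *m A *m X = X,
      (A *m X)^T = A *m X
    & (X *m A)^T = X *m A].

Lemma is_mpinv_uniq (R : realType) (m n : nat) (A : 'M[R]_(m, n))
    (X Y : 'M[R]_(n, m)) :
  is_mpinv A X -> is_mpinv A Y -> X = Y.
Proof.
move=> [AXA XAX sAX sXA] [AYA YAY sAY sYA].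
have eAX : A *m X = A *m Y.
  rewrite -sAX -[in LHS]AYA -!mulmxA mulmxA trmx_mul sAX sAY.
  by rewrite !mulmxA AXA.
have eXA : X *m A = Y *m A.
  rewrite -sXA -[in LHS]AYA -mulmxA mulmxA trmx_mul sYA sXA.
  by rewrite -!mulmxA (mulmxA A) AXA.
by rewrite -XAX eXA -mulmxA eAX mulmxA YAY.
Qed.

Lemma row_free_gram (R : realType) (m n : nat) (F : 'M[R]_(m, n)) :
  row_free F -> F *m F^T \in unitmx.
Proof.
move=> rF; rewrite -row_free_unit -kermx_eq0; apply/rowV0P => v /sub_kermxP v0.
have h : v *m F *m (v *m F)^T = 0.
  by rewrite trmx_mul mulmxA -(mulmxA v) v0 mul0mx.
suff vF : v *m F = 0 by apply: (row_free_inj rF); rewrite vF mul0mx.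
apply/rowP => j; rewrite [RHS]mxE; apply/eqP; rewrite -sqrf_eq0.
move/matrixP/(_ 0 0): h; rewrite !mxE => /eqP.
under eq_bigr do rewrite [X in _ * X]mxE -expr2.
rewrite psumr_eq0 => [/allP/(_ j)|k _]; last exact: sqr_ge0.
by rewrite mem_index_enum mxE => /(_ isT).
Qed.

Lemma is_mpinv_exists (R : realType) (m n : nat) (A : 'M[R]_(m, n)) :
  exists X, is_mpinv A X.
Proof.
have [k [C [F [fC fF eA]]]] : exists k (C : 'M[R]_(m, k)) (F : 'M[R]_(k, n)),
    [/\ row_full C, row_free F & A = C *m F].
  exists (\rank A), (col_base A), (row_base A); split.
  - exact: col_base_full.
  - exact: row_base_free.
  - by rewrite mulmx_base.
have uF : F *m F^T \in unitmx by exact: row_free_gram.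
have uC : C^T *m C \in unitmx.
  rewrite -{2}(trmxK C); apply: row_free_gram.
  by rewrite /row_free mxrank_tr; exact: fC.
have sF : (invmx (F *m F^T))^T = invmx (F *m F^T).
  by rewrite trmx_inv trmx_mul trmxK.
have sC : (invmx (C^T *m C))^T = invmx (C^T *m C).
  by rewrite trmx_inv trmx_mul trmxK.
pose P := F^T *m invmx (F *m F^T); pose Q := invmx (C^T *m C) *m C^T.
have FP : F *m P = 1%:M by rewrite mulmxA mulmxV.
have QC : Q *m C = 1%:M by rewrite -mulmxA mulVmx.
have AX : A *m (P *m Q) = C *m Q.
  by rewrite eA mulmxA -(mulmxA C) FP mulmx1.
have XA : P *m Q *m A = P *m F.
  by rewrite eA mulmxA -(mulmxA P) QC mulmx1.
exists (P *m Q); split; rewrite ?AX ?XA.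
- by rewrite eA mulmxA -(mulmxA C) QC mulmx1.
- by rewrite mulmxA -(mulmxA P) FP mulmx1.
- by rewrite /Q !trmx_mul trmxK sC mulmxA.
- by rewrite /P !trmx_mul trmxK sF mulmxA.
Qed.

(* The Moore-Penrose pseudoinverse; the library's [pinvmx] satisfies only
   the first Penrose equation in general. *)
Definition mpinv (R : realType) (m n : nat) (A : 'M[R]_(m, n)) : 'M[R]_(n, m) :=
  xget 0 [set X | is_mpinv A X]%classic.

Lemma mpinvP (R : realType) (m n : nat) (A : 'M[R]_(m, n)) :
  is_mpinv A (mpinv A).
Proof. by case: (is_mpinv_exists A) => X XP; apply: (xgetPex 0); exists X. Qed.

(* A weight function on unordered pairs of distinct vertices is encoded as a
   symmetric matrix with zero diagonal, namely the adjacency matrix. *)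
Record wgraph (R : realType) (n : nat) := WGraph {
  weight :> 'M[R]_n;
  weight_ge0 : forall i j, 0 <= weight i j;
  weight_sym : forall i j, weight i j = weight j i;
  weight_diag : forall i, weight i i = 0
}.

Definition edge (R : realType) (n : nat) (G : wgraph R n) : rel 'I_n :=
  fun i j => G i j != 0.

Definition connected_graph (R : realType) (n : nat) (G : wgraph R n) : Prop :=
  forall i j : 'I_n, connect (edge G) i j.

Definition degree_mx (R : realType) (n : nat) (G : wgraph R n) : 'M[R]_n :=
  diag_mx (\row_i \sum_j G i j).

Definition laplacian (R : realType) (n : nat) (G : wgraph R n) : 'M[R]_n :=
  degree_mx G - weight G.

Definition effective_resistance (R : realType) (n : nat) (G : wgraph R n)
    (i j : 'I_n) : R :=
  let u : 'cV[R]_n := delta_mx i 0 - delta_mx j 0 in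
  (u^T *m mpinv (laplacian G) *m u) 0 0.

Definition unordered_pairs (n : nat) : {set {set 'I_n}} :=
  [set e : {set 'I_n} | #|e| == 2%N].

(* Only the values of [w] on [I] and of [r] on [J] matter. *)
Definition realizes (R : realType) (n : nat) (I J : {set {set 'I_n}})
    (w r : {set 'I_n} -> R) (G : wgraph R n) : Prop :=
  (forall i j : 'I_n, [set i; j] \in I -> G i j = w [set i; j]) /\
  (forall i j : 'I_n, [set i; j] \in J ->
     effective_resistance G i j = r [set i; j]).

(* Main.v *)
(** Write [L, M] for the Laplacians of two realizing graphs and [P, Q] for their
pseudoinverses. The trace of [(L - M) (P - Q)] is the sum over all pairs of
(difference of weights) * (difference of resistances), so it vanishes. By
connectedness [L] and [M] have the same kernel, hence [L P = M Q] is the same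
projection and [P - Q = - P (L - M) Q]. Therefore
[tr (L N M N^T) = 0] for [N = P (L - M) Q]; as Laplacians are positive
semidefinite this forces [L N M = 0], and [L N M] is just [L - M]. *)
Require Import Defs.
From HB Require Import structures.
From mathcomp Require Import all_boot all_order all_algebra.
From mathcomp Require Import reals.

Set Implicit Arguments.
Unset Strict Implicit.
Unset Printing Implicit Defensive.

Import Order.TTheory GRing.Theory Num.Theory.

Local Open Scope ring_scope.

Lemma is_mpinv_tr (R : realType) (m n : nat) (A : 'M[R]_(m, n)) X :
  is_mpinv A X -> is_mpinv A^T X^T.
Proof.
move=> [AXA XAX sAX sXA]; split.
- by rewrite -!trmx_mul mulmxA AXA.
- by rewrite -!trmx_mul mulmxA XAX.
- by rewrite -trmx_mul sXA.
- by rewrite -trmx_mul sAX.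
Qed.

(** The transpose of [mpinv A] also satisfies the Penrose equations for [A], and their solution is
    unique. *)
Lemma mpinv_sym (R : realType) (n : nat) (A : 'M[R]_n) :
  A^T = A -> (mpinv A)^T = mpinv A.
Proof.
move=> sA; apply: (@is_mpinv_uniq _ _ _ A); last exact: mpinvP.
by rewrite -{1}sA; apply: is_mpinv_tr; exact: mpinvP.
Qed.

Lemma mpinv_symC (R : realType) (n : nat) (A : 'M[R]_n) :
  A^T = A -> A *m mpinv A = mpinv A *m A.
Proof.
move=> sA; have [_ _ sAX _] := mpinvP A.
by rewrite -sAX trmx_mul sA mpinv_sym.
Qed.

Section Laplacian.
Variables (R : realType) (n : nat).
Implicit Types (G H : wgraph R n) (i j k : 'I_n).

Definition incidence i j : 'cV[R]_n := delta_mx i 0 - delta_mx j 0.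

Lemma mul_tr_incidence i j p (A : 'M[R]_(n, p)) :
  (incidence i j)^T *m A = row i A - row j A.
Proof. by rewrite linearB /= !trmx_delta mulmxBl -!rowE. Qed.

Lemma laplacian_tr G : (laplacian G)^T = laplacian G.
Proof.
rewrite /laplacian linearB /= tr_diag_mx; congr (_ - _).
by apply/matrixP => i j; rewrite mxE weight_sym.
Qed.

Lemma laplacian_mulE G p (A : 'M[R]_(n, p)) i (k : 'I_p) :
  (laplacian G *m A) i k = \sum_j G i j * (A i k - A j k).
Proof.
rewrite /laplacian /degree_mx mulmxBl mul_diag_mx !mxE mulr_suml -sumrB.
by apply: eq_bigr => j _; rewrite mulrBr.
Qed.

(* The factor 2 comes from summing over ordered pairs. *)
Lemma laplacian_trace G (M : 'M[R]_n) :
  \tr (laplacian G *m M) *+ 2 =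
  \sum_i \sum_j G i j * ((incidence i j)^T *m M *m incidence i j) 0 0.
Proof.
have trE : \tr (laplacian G *m M) = \sum_i \sum_j G i j * (M i i - M j i).
  by apply: eq_bigr => i _; rewrite laplacian_mulE.
(* Swapping [i] and [j] in one of the two copies completes [M i i - M j i] to the quadratic form
   [M i i - M j i + M j j - M i j]. *)
rewrite mulr2n {2}trE exchange_big trE -big_split; apply: eq_bigr => i _ /=.
rewrite -big_split; apply: eq_bigr => j _ /=.
rewrite mul_tr_incidence /incidence mulmxBr -!colE !mxE (weight_sym G j i).
by rewrite -mulrDr -[M j j - _]opprB.
Qed.

(** This is the trace formula for the rank-one matrix [v *m v^T], since the quadratic form is the
    trace of [laplacian G *m (v *m v^T)]. *)
Lemma laplacian_quad G (v : 'cV[R]_n) :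
  (v^T *m laplacian G *m v) 0 0 *+ 2 =
  \sum_i \sum_j G i j * (v i 0 - v j 0) ^+ 2.
Proof.
rewrite -trace_mx11 -mulmxA mxtrace_mulC -mulmxA laplacian_trace.
apply: eq_bigr => i _; apply: eq_bigr => j _.
rewrite mulmxA mul_tr_incidence -mulmxA -[v^T *m _]trmxK trmx_mul trmxK.
by rewrite mul_tr_incidence mxE big_ord1 !mxE expr2.
Qed.

Lemma laplacian_quad_ge0 G (v : 'cV[R]_n) :
  0 <= (v^T *m laplacian G *m v) 0 0.
Proof.
rewrite -(pmulrn_lge0 _ (n := 2)) // laplacian_quad.
by do 2![apply: sumr_ge0 => ? _]; rewrite mulr_ge0 ?weight_ge0 ?sqr_ge0.
Qed.

Lemma psumr2_eq0P (F : 'I_n -> 'I_n -> R) :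
  (forall i j, 0 <= F i j) -> \sum_i \sum_j F i j = 0 ->
  forall i j, F i j = 0.
Proof.
move=> F0 S0 i j; apply: (psumr_eq0P (P := predT) (F := F i)) => //.
by apply: (psumr_eq0P (P := predT) (F := fun i => \sum_j F i j)) => // k _;
  apply: sumr_ge0.
Qed.

Lemma laplacian_quad_eq0 G (v : 'cV[R]_n) :
  (v^T *m laplacian G *m v) 0 0 = 0 ->
  forall i j, G i j * (v i 0 - v j 0) = 0.
Proof.
move=> v0 i j; have := laplacian_quad G v; rewrite v0 mul0rn => /esym S0.
have /eqP := psumr2_eq0P (fun i j => mulr_ge0 (weight_ge0 G i j)
  (sqr_ge0 (v i 0 - v j 0))) S0 i j.
by rewrite mulf_eq0 sqrf_eq0 -mulf_eq0 => /eqP.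
Qed.

Lemma laplacian_ker_quad G (v : 'cV[R]_n) :
  (v^T *m laplacian G *m v) 0 0 = 0 -> laplacian G *m v = 0.
Proof.
move=> v0; apply/colP => i; rewrite laplacian_mulE mxE big1 // => j _.
exact: laplacian_quad_eq0.
Qed.

(** By the trace formula, twice the trace sums [G i j] times the quadratic form of [laplacian H] at
    [N^T *m incidence i j]. All terms are nonnegative, so all vanish: whenever [G i j] is nonzero,
    rows [i] and [j] of [N *m laplacian H] agree, and [laplacian G] sees only such row
    differences. *)
Lemma laplacian_trace_eq0 G H (N : 'M[R]_n) :
  \tr (laplacian G *m (N *m laplacian H *m N^T)) = 0 ->
  laplacian G *m N *m laplacian H = 0.
Proof.
move=> t0; have := laplacian_trace G (N *m laplacian H *m N^T).
rewrite t0 mul0rn => /esym.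
under eq_bigr do under eq_bigr => j _ do
  rewrite !mulmxA -(mulmxA (_ *m _)) -[_^T *m N]trmxK trmx_mul trmxK.
move=> /psumr2_eq0P-/(_ (fun i j => mulr_ge0 (weight_ge0 G i j)
  (laplacian_quad_ge0 H _))) q0.
apply/matrixP => i k; rewrite -mulmxA laplacian_mulE [RHS]mxE.
apply: big1 => j _; have /eqP := q0 i j.
rewrite mulf_eq0 => /orP[/eqP->|/eqP/laplacian_ker_quad]; first by rewrite mul0r.
move/(congr1 trmx); rewrite !trmx_mul !trmxK laplacian_tr trmx0 -mulmxA.
rewrite mul_tr_incidence => /rowP/(_ k).
by rewrite [LHS]mxE [in LHS]mxE [X in _ + X]mxE !mxE => ->; rewrite mulr0.
Qed.

(** A column killed by the Laplacian of [G] is constant along edges, hence constant by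
    connectedness, and every Laplacian kills constants. *)
Lemma laplacian_ker_connected G H p (A : 'M[R]_(n, p)) :
  connected_graph G -> laplacian G *m A = 0 -> laplacian H *m A = 0.
Proof.
move=> cG A0; apply/matrixP => i k; rewrite laplacian_mulE [RHS]mxE.
have q0 : ((col k A)^T *m laplacian G *m col k A) 0 0 = 0.
  by rewrite -mulmxA colE [X in _ *m X]mulmxA A0 mul0mx mulmx0 mxE.
have Ae a b : edge G a b -> A a k = A b k.
  move=> ab; have /eqP := laplacian_quad_eq0 q0 a b.
  by rewrite mulf_eq0 (negPf ab) /= subr_eq0 !mxE => /eqP.
have Ac a b : A a k = A b k.
  have /connectP[s + ->] := cG a b.
  by elim: s a => //= c s IH a /andP[/Ae-> /IH].
by apply: big1 => j _; rewrite (Ac i j) subrr mulr0.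
Qed.

(** Off-diagonal entries are the negated weights, diagonal weights are zero, and the other fields of
    the record are proofs, equal by proof irrelevance. *)
Lemma laplacian_inj G H : laplacian G = laplacian H -> G = H.
Proof.
move=> eL; have eW : weight G = weight H.
  apply/matrixP => i j; have [->|ne_ij] := eqVneq i j.
    by rewrite !weight_diag.
  have /matrixP/(_ i j) := eL.
  by rewrite !mxE (negPf ne_ij) !mulr0n !sub0r => /oppr_inj.
case: G H eW {eL} => [A a1 a2 a3] [B b1 b2 b3] /= eAB.
by subst B; congr WGraph; exact: boolp.Prop_irrelevance.
Qed.

Lemma laplacian_mpinv_connected G H :
  connected_graph G -> connected_graph H ->
  laplacian G *m mpinv (laplacian G) = laplacian H *m mpinv (laplacian H).
Proof.
(* The columns of [1 - mpinv L *m L], with [L] the Laplacian of [K], lie in the kernel of [L], hence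
   in that of [K']. *)
have absorb (K K' : wgraph R n) : connected_graph K ->
    (laplacian K' *m mpinv (laplacian K')) *m
    (laplacian K *m mpinv (laplacian K)) =
    laplacian K' *m mpinv (laplacian K').
  move=> cK; have [LXL _ _ _] := mpinvP (laplacian K).
  rewrite (mpinv_symC (laplacian_tr K)) (mpinv_symC (laplacian_tr K')).
  rewrite -[LHS]mulmxA; congr (_ *m _).
  apply/eqP; rewrite eq_sym -subr_eq0 -[X in X - _]mulmx1 -mulmxBr; apply/eqP.
  apply: (laplacian_ker_connected _ cK).
  by rewrite mulmxBr mulmx1 mulmxA LXL subrr.
(* Each of the two symmetric projections absorbs the other on its right; transposing one of these
   identities makes them equal. *)
move=> cG cH; rewrite -(absorb H G) //.
have [_ _ sG _] := mpinvP (laplacian G).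
have [_ _ sH _] := mpinvP (laplacian H).
by rewrite -sG -sH -trmx_mul absorb.
Qed.

Lemma trace_laplacian_resistance G H :
  \tr ((laplacian G - laplacian H) *m
       (mpinv (laplacian G) - mpinv (laplacian H))) *+ 2 =
  \sum_i \sum_j (G i j - H i j) *
    (effective_resistance G i j - effective_resistance H i j).
Proof.
rewrite mulmxBl linearB /= mulrnBl !laplacian_trace -sumrB.
apply: eq_bigr => i _; rewrite -sumrB; apply: eq_bigr => j _.
rewrite -mulrBl (mulmxBr (incidence i j)^T) mulmxBl; congr (_ * _).
by rewrite [LHS]mxE [X in _ + X]mxE.
Qed.

Lemma laplacian_eq_of_trace G H :
  connected_graph G -> connected_graph H ->
  \tr ((laplacian G - laplacian H) *m
       (mpinv (laplacian G) - mpinv (laplacian H))) = 0 ->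
  laplacian G = laplacian H.
Proof.
move=> cG cH; have eP := laplacian_mpinv_connected cG cH.
have CG := mpinv_symC (laplacian_tr G); have CH := mpinv_symC (laplacian_tr H).
have sP := mpinv_sym (laplacian_tr G); have sQ := mpinv_sym (laplacian_tr H).
have [LPL PLP _ _] := mpinvP (laplacian G).
have [MQM QMQ _ _] := mpinvP (laplacian H).
have sL := laplacian_tr G; have sM := laplacian_tr H.
move: (@laplacian_trace_eq0 G H).
set L := laplacian G in eP CG LPL PLP sP sL *.
set M := laplacian H in eP CH MQM QMQ sQ sM *.
set P := mpinv L in eP CG LPL PLP sP *.
set Q := mpinv M in eP CH MQM QMQ sQ *.
set Z := L - M => tr_eq0 t0.
(* Here [P *m L = Q *m M] fixes [Q] from the left, and [M *m Q = L *m P] fixes [P] from the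
   right. *)
have PZQ : P *m Z *m Q = Q - P.
  rewrite mulmxBr mulmxBl -CG eP CH QMQ; congr (_ - _).
  by rewrite -mulmxA -eP mulmxA PLP.
have LPZ : L *m P *m Z = Z by rewrite mulmxBr LPL eP MQM.
have ZQM : Z *m Q *m M = Z.
  by rewrite -mulmxA -CH -eP CG mulmxBl mulmxA LPL -CG eP CH mulmxA MQM.
apply/eqP; rewrite -subr_eq0 -/Z; apply/eqP.
have <- : L *m (P *m Z *m Q) *m M = Z.
  by rewrite !mulmxA LPZ ZQM.
apply: tr_eq0.
have -> : (P *m Z *m Q)^T = Q *m Z *m P.
  by rewrite !trmx_mul sP sQ linearB /= sL sM mulmxA.
have -> : L *m (P *m Z *m Q *m M *m (Q *m Z *m P)) = Z *m Q *m (Z *m P).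
  by rewrite !mulmxA LPZ ZQM.
(* A cyclic shift yields the trace of [Z *m (P *m Z *m Q)], which is minus the trace assumed to
   vanish. *)
rewrite mxtrace_mulC -mulmxA (mulmxA P) PZQ -opprB mulmxN linearN /=.
by rewrite t0 oppr0.
Qed.

End Laplacian.

Theorem mainTheorem14 (R : realType) (n : nat) (I J : {set {set 'I_n}})
    (w r : {set 'I_n} -> R) :
  (0 < n)%N ->
  I :|: J = unordered_pairs n ->
  I :&: J = set0 ->
  (forall e, e \in I -> 0 <= w e) ->
  (forall e, e \in J -> 0 < r e) ->
  forall G H : wgraph R n,
    connected_graph G -> realizes I J w r G ->
    connected_graph H -> realizes I J w r H ->
    G = H.
Proof.
move=> _ eIJ _ _ _ G H cG [wG rG] cH [wH rH].
apply/laplacian_inj/laplacian_eq_of_trace => //.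
apply/eqP; rewrite -[_ == 0](mulrn_eq0 _ 2) trace_laplacian_resistance.
apply/eqP; apply: big1 => i _; apply: big1 => j _.
(* Diagonal terms vanish because there are no loops. Any other pair lies in [I], where the weights
   agree, or in [J], where the resistances do. *)
have [<-|ne_ij] := eqVneq i j; first by rewrite !weight_diag subrr mul0r.
have : [set i; j] \in I :|: J by rewrite eIJ inE cards2 ne_ij.
rewrite inE => /orP[ijI|ijJ]; first by rewrite wG ?wH // subrr mul0r.
by rewrite rG ?rH // subrr mulr0.
Qed.
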